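(* Let $F$ be a field with a nontrivial valuation $v$ and valuation domain $O_v$. Let $R$ be a torsion-free algebra over $O_v$ such that $[R\otimes_{O_v}F:F]<\infty$ and $(R^{\times}\cap O_v)\subseteq O_v^{\times}$. Then $$|\operatorname{Spec}(O_v)|\le|\operatorname{Spec}(R)|\le [R\otimes_{O_v}F:F]\cdot|\operatorname{Spec}(O_v)|.$$
   Context: $O_v=\{x\in F: v(x)\ge0\}$. Rings are associative with $1$, not necessarily commutative; $\operatorname{Spec}(R)$ is the set of prime (two-sided) ideals and $|\cdot|$ denotes cardinality. An $O_v$-algebra is a ring $R$ with a unitary ring homomorphism $O_v\to Z(R)$, $c\mapsto c\cdot 1_R$; it is torsion-free if $cr=0$ with $c\in O_v$, $r\in R$ implies $c=0$ or $r=0$. $R^\times\cap O_v=\{c\in O_v: c\cdot 1_R\in R^\times\}$. $[V:F]$ denotes the dimension of $V$ over $F$. *)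

(* Defs.v *)
From HB Require Import structures.
From mathcomp Require Import all_boot all_order all_algebra.
From mathcomp Require Import boolp classical_sets functions cardinality.
From mathcomp Require Import freeg.
Set Implicit Arguments.
Unset Strict Implicit.
Unset Printing Implicit Defensive.
Import Order.TTheory GRing.Theory Num.Theory.
Local Open Scope classical_set_scope.
Local Open Scope quotient_scope.
Local Open Scope ring_scope.

(* The order of a [porderZmodType] carries no compatibility with the addition,
   and is only partial. *)
HB.mixin Record isOrderedAbGroup G of Num.POrderedZmodule G := {
  oag_total : forall x y : G, (x <= y) || (y <= x);
  oag_lerD2l : forall x y z : G, x <= y -> z + x <= z + y
}.

#[short(type="orderedAbGroupType")]
HB.structure Definition OrderedAbGroup :=
  { G of isOrderedAbGroup G & Num.POrderedZmodule G }.

(* Values live in [option G], where [None] stands for infinity. *)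
Section ExtendedGroup.
Variable G : orderedAbGroupType.

Definition ext_add (a b : option G) : option G :=
  match a, b with Some x, Some y => Some (x + y) | _, _ => None end.

Definition ext_le (a b : option G) : bool :=
  match a, b with
  | _, None => true
  | None, Some _ => false
  | Some x, Some y => x <= y
  end.

Definition ext_min (a b : option G) : option G := if ext_le a b then a else b.

Lemma ext_le_trans a b c : ext_le a b -> ext_le b c -> ext_le a c.
Proof. by case: a b c => [a|] [b|] [c|] //=; exact: le_trans. Qed.

Lemma ext_le_min a b c : ext_le c a -> ext_le c b -> ext_le c (ext_min a b).
Proof. by rewrite /ext_min; case: ifP. Qed.

Lemma ext_add_ge0 a b :
  ext_le (Some 0) a -> ext_le (Some 0) b -> ext_le (Some 0) (ext_add a b).
Proof.
case: a b => [a|] [b|] //= a0 b0; apply: le_trans a0 _.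
by rewrite -{1}[a]addr0; exact: oag_lerD2l.
Qed.
End ExtendedGroup.

Record valuation (F : fieldType) (G : orderedAbGroupType) := Valuation {
  val_of :> F -> option G;
  val_eqN : forall x, val_of x = None <-> x = 0;
  val_M : forall x y, val_of (x * y) = ext_add (val_of x) (val_of y);
  val_D : forall x y,
    ext_le (ext_min (val_of x) (val_of y)) (val_of (x + y)) }.

Definition nontrivial_valuation (F : fieldType) (G : orderedAbGroupType)
    (v : valuation F G) : Prop :=
  exists2 x : F, x != 0 & v x <> Some 0.

Section ValuationRing.
Variables (F : fieldType) (G : orderedAbGroupType) (v : valuation F G).

Definition valuation_ring_pred : pred F := fun x => ext_le (Some 0) (v x).

Lemma val_1 : v 1 = Some 0.
Proof.
have := val_M v 1 1; rewrite mulr1; case E: (v 1) => [g|] /=.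
  by move=> [gE]; congr Some; apply: (addrI g); rewrite addr0 -gE.
by move: E => /val_eqN /eqP; rewrite oner_eq0.
Qed.

Lemma val_N1 : v (-1) = Some 0.
Proof.
have := val_M v (-1) (-1); rewrite mulrNN mulr1 val_1.
case: (v _) => [g|] //= [] gE; congr Some; apply/eqP.
have add_le (x y : G) : x <= 0 -> y <= 0 -> x + y <= 0 /\ (x + y = 0 -> y = 0).
  move=> x0 y0; have H : x + y <= x by rewrite -{2}[x]addr0 oag_lerD2l.
  split; first exact: le_trans x0.
  by move=> xy; apply/le_anti; rewrite y0 -xy addrC -{2}[y]addr0 oag_lerD2l.
have /orP[g0|g0] := oag_total g 0; first by apply/eqP/(proj2 (add_le _ _ g0 g0)).
rewrite -oppr_eq0; apply/eqP.
have Ng : - g <= 0 by have := oag_lerD2l 0 g (- g) g0; rewrite addr0 addNr.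
by apply/(proj2 (add_le _ _ Ng Ng)); rewrite -opprD -gE oppr0.
Qed.

Lemma valuation_ring_pred_subring : subring_closed valuation_ring_pred.
Proof.
split=> [|x y|x y]; rewrite !unfold_in /valuation_ring_pred.
- by rewrite val_1 /=; exact: lexx.
- move=> x0 y0; apply: ext_le_trans (val_D v x (- y)); apply: ext_le_min => //.
  by rewrite -mulN1r val_M val_N1; apply: ext_add_ge0 => //=; exact: lexx.
- by rewrite val_M; exact: ext_add_ge0.
Qed.

HB.instance Definition _ :=
  GRing.isSubringClosed.Build F valuation_ring_pred valuation_ring_pred_subring.

Record valuation_ring := ValuationRing {
  valuation_ring_val :> F;
  _ : valuation_ring_val \in valuation_ring_pred }.

HB.instance Definition _ := [isSub for valuation_ring_val].
HB.instance Definition _ := [Choice of valuation_ring by <:].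
HB.instance Definition _ := [SubChoice_isSubComNzRing of valuation_ring by <:].
End ValuationRing.

Definition is_unit (A : pzRingType) (a : A) : Prop :=
  exists b : A, a * b = 1 /\ b * a = 1.

Definition torsion_free (A : pzRingType) (M : lmodType A) : Prop :=
  forall (a : A) (m : M), a *: m = 0 -> a = 0 \/ m = 0.

Section Spec.
Variable A : pzRingType.

Definition two_sided_ideal (I : set A) : Prop :=
  [/\ I 0, forall x y, I x -> I y -> I (x + y),
      forall a x, I x -> I (a * x) & forall a x, I x -> I (x * a)].

(* The product ideal IJ consists of the finite sums of the x * y with x in I
   and y in J, so the premise of the last clause says that IJ is contained
   in P. *)
Definition prime_ideal (P : set A) : Prop :=
  [/\ two_sided_ideal P, P <> setT &
      forall I J : set A, two_sided_ideal I -> two_sided_ideal J ->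
        (forall x y, I x -> J y -> P (x * y)) -> I `<=` P \/ J `<=` P].

Definition Spec : set (set A) := [set P | prime_ideal P].
End Spec.
Arguments Spec A : clear implicits.

Section BaseChange.
Variables (A B : comNzRingType) (f : {rmorphism A -> B}) (M : lmodType A).

Inductive tensor_relation : {freeg (M * B)} -> Prop :=
| TensorRel0 : tensor_relation 0
| TensorRelB s t :
    tensor_relation s -> tensor_relation t -> tensor_relation (s - t)
| TensorRelDl m m' b :
    tensor_relation (<< (m + m', b) >> - << (m, b) >> - << (m', b) >>)
| TensorRelDr m b b' :
    tensor_relation (<< (m, b + b') >> - << (m, b) >> - << (m, b') >>)
| TensorRelZ a m b :
    tensor_relation (<< (a *: m, b) >> - << (m, f a * b) >>).

Definition tensor_relation_pred : pred {freeg (M * B)} :=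
  fun s => `[< tensor_relation s >].

Lemma tensor_relation_zmod : zmod_closed tensor_relation_pred.
Proof.
split=> [|s t]; rewrite !unfold_in; first by apply/asboolP; exact: TensorRel0.
by move=> /asboolP hs /asboolP ht; apply/asboolP; exact: TensorRelB.
Qed.

HB.instance Definition _ := GRing.isZmodClosed.Build {freeg (M * B)}
  tensor_relation_pred tensor_relation_zmod.

Definition tensor_relation_group : zmodClosed {freeg (M * B)} :=
  GRing.ZmodClosed.clone _ tensor_relation_pred _.

(* M (x)_A B: the free abelian group on M * B modulo the bilinearity and
   A-balancing relations; B acts on the second factor. *)
Definition base_change : Type := {ideal_quot tensor_relation_group}.
HB.instance Definition _ := GRing.Zmodule.on base_change.

Definition tensor_class (s : {freeg (M * B)}) : base_change :=
  \pi_({ideal_quot tensor_relation_group}) s.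

Definition pure_tensor (m : M) (b : B) : base_change :=
  tensor_class << (m, b) >>.

Lemma tensor_class_is_zmod_morphism : zmod_morphism tensor_class.
Proof. by move=> s t; rewrite /tensor_class [LHS]pi_is_zmod_morphism. Qed.
HB.instance Definition _ :=
  GRing.isZmodMorphism.Build _ _ tensor_class tensor_class_is_zmod_morphism.

Lemma tensor_class_eq0 s : tensor_class s = 0 <-> tensor_relation s.
Proof.
rewrite -[0](raddf0 tensor_class); split.
  move=> /eqP; rewrite /tensor_class -Quotient.idealrBE subr0 unfold_in.
  by move=> /asboolP.
move=> hs; apply/eqP; rewrite /tensor_class -Quotient.idealrBE subr0 unfold_in.
exact/asboolP.
Qed.

Definition pre_scale (b : B) (s : {freeg (M * B)}) : {freeg (M * B)} :=
  fglift (fun p : M * B => << (p.1, b * p.2) >> : {freeg (M * B)}) s.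

Lemma pre_scale_is_zmod_morphism b : zmod_morphism (pre_scale b).
Proof. exact: lift_is_additive. Qed.
HB.instance Definition _ b :=
  GRing.isZmodMorphism.Build _ _ (pre_scale b) (pre_scale_is_zmod_morphism b).

Lemma pre_scaleU b m c : pre_scale b << (m, c) >> = << (m, b * c) >>.
Proof. by rewrite /pre_scale liftU scale1r. Qed.

Lemma freeg_gen_ind (P : {freeg (M * B)} -> Prop) :
  P 0 -> (forall s t, P s -> P t -> P (s - t)) -> 
  (forall m b, P << (m, b) >>) -> forall s, P s.
Proof.
move=> P0 PB PU s.
have PN t : P t -> P (- t) by move=> Pt; rewrite -sub0r; exact: PB.
have PD t u : P t -> P u -> P (t + u).
  by move=> Pt Pu; rewrite -[u]opprK; apply: PB => //; exact: PN.
have PM t k : P t -> P (t *+ k).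
  by move=> Pt; elim: k => [|k IH]; rewrite ?mulr0n // mulrS; exact: PD.
rewrite -[s]freeg_sumE; elim/big_ind: _ => // -[m b] _.
set k := coeff _ _.
have -> : << k *g (m, b) >> = << (m, b) >> *~ k :> {freeg (M * B)}.
  by rewrite freegU_mulz intz.
case: k => k; first exact: PM.
by rewrite NegzE mulrNz; apply: PN; exact: PM.
Qed.

Lemma pre_scale_relation b s : tensor_relation s -> tensor_relation (pre_scale b s).
Proof.
elim=> [|t u _ ht _ hu|m m' c|m c c'|a m c].
- by rewrite raddf0; exact: TensorRel0.
- by rewrite raddfB; exact: TensorRelB.
- by rewrite !raddfB /= !pre_scaleU; exact: TensorRelDl.
- by rewrite !raddfB /= !pre_scaleU mulrDr; exact: TensorRelDr.
- by rewrite !raddfB /= !pre_scaleU mulrCA; exact: TensorRelZ.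
Qed.

Definition base_change_scale (b : B) (t : base_change) : base_change :=
  tensor_class (pre_scale b (repr t)).

Lemma tensor_classP (t : base_change) : exists s, t = tensor_class s.
Proof. by exists (repr t); rewrite /tensor_class [RHS]reprK. Qed.

Lemma base_change_scaleE b s :
  base_change_scale b (tensor_class s) = tensor_class (pre_scale b s).
Proof.
apply/eqP; rewrite -subr_eq0 -raddfB /=; apply/eqP/tensor_class_eq0.
rewrite -raddfB; apply/pre_scale_relation/tensor_class_eq0.
by rewrite raddfB /= /tensor_class [X in X - _]reprK subrr.
Qed.

Lemma base_change_scaleA a b t :
  base_change_scale a (base_change_scale b t) = base_change_scale (a * b) t.
Proof.
have [s ->] := tensor_classP t; rewrite !base_change_scaleE; congr tensor_class.
elim/freeg_gen_ind: s => [|s u hs hu|m c]; first by rewrite !raddf0.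
- by rewrite !raddfB /= hs hu.
- by rewrite !pre_scaleU mulrA.
Qed.

Lemma base_change_scale1 : left_id 1 base_change_scale.
Proof.
move=> t; have [s ->] := tensor_classP t; rewrite !base_change_scaleE.
congr tensor_class.
elim/freeg_gen_ind: s => [|s u hs hu|m c]; first by rewrite !raddf0.
- by rewrite !raddfB /= hs hu.
- by rewrite !pre_scaleU mul1r.
Qed.

Lemma base_change_scaleDr : right_distributive base_change_scale +%R.
Proof.
move=> b t u; have [s ->] := tensor_classP t; have [s' ->] := tensor_classP u.
by rewrite -raddfD !base_change_scaleE !raddfD.
Qed.

Lemma base_change_scaleDl t :
  {morph base_change_scale^~ t : a b / a + b}.
Proof.
move=> a b; have [s ->] := tensor_classP t; rewrite !base_change_scaleE.
elim/freeg_gen_ind: s => [|s u hs hu|m c]; first by rewrite !raddf0 addr0.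
- by rewrite !raddfB /= hs hu opprD addrACA.
- apply/eqP; rewrite !pre_scaleU mulrDl -subr_eq0 opprD addrA -!raddfB /=.
  by apply/eqP/tensor_class_eq0/TensorRelDr.
Qed.

HB.instance Definition _ := GRing.Zmodule_isLmodule.Build B base_change
  base_change_scaleA base_change_scale1 base_change_scaleDr base_change_scaleDl.

Lemma base_change_scale_pure b m c :
  b *: pure_tensor m c = pure_tensor m (b * c).
Proof. by rewrite [LHS]base_change_scaleE pre_scaleU. Qed.
End BaseChange.

(* [V : K] = n *)
Definition has_dimension (K : fieldType) (V : lmodType K) (n : nat) : Prop :=
  exists e : 'I_n -> V,
    (forall c : 'I_n -> K, \sum_(i < n) c i *: e i = 0 -> forall i, c i = 0) /\
    (forall x : V, exists c : 'I_n -> K, x = \sum_(i < n) c i *: e i).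

Definition valuation_ring_incl (F : fieldType) (G : orderedAbGroupType)
  (v : valuation F G) : {rmorphism valuation_ring v -> F} := \val.

(* Main.v *)
Require Import Defs.
From HB Require Import structures.
From mathcomp Require Import all_boot all_order all_algebra.
From mathcomp Require Import boolp classical_sets functions cardinality freeg.
Set Implicit Arguments.
Unset Strict Implicit.
Unset Printing Implicit Defensive.
Import Order.TTheory GRing.Theory Num.Theory.
Local Open Scope classical_set_scope.
Local Open Scope card_scope.
Local Open Scope ring_scope.

(** Write p for a prime of O = O_v and Q for a prime of R; Q lies over p when p
is the contraction of Q.  Both inequalities come from contracting primes: every p
has some Q over it, and no p has more than n of them.

The dimension enters in one form only, [unit_relations]: any n + 1 elements of R
satisfy a linear relation over O in which some coefficient is 1.  A linear
relation over F among their images in the base change is divided by a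
coefficient of least value, and brought back to R because R embeds in the base
change ([pure_tensor_inj]).

A relation with a coefficient 1 stays nontrivial modulo every p, so R has
dimension at most n over the residue field k(p) as well.  Here k(p)-subspaces
appear as [local_submodule]s of R; their strict chains have length at most n
([no_long_chain]), so nonempty families of them have maximal and minimal
elements.

Fibres have at most n elements.  The primes over p are the primes of a finite
dimensional k(p)-algebra, hence pairwise incomparable ([prime_incomparable]).
Given n + 1 distinct primes Q_i over p, one finds r_i in all Q_k with k <> i but
not in Q_i; a relation between the r_i whose j-th coefficient is 1, read modulo
Q_j, puts r_j into Q_j.

Fibres are not empty ([lying_over]).  If some s outside p were a multiple
q r of some q in p, then q = s t with t in p as O is a valuation ring, and
torsion-freeness gives t r = 1: then t is a unit of R, hence of O, although it
lies in p.  So the local closure of pR is proper, and a proper two-sided local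
ideal that is maximal among those containing it is a prime over p. *)

(** * Two-sided prime ideals *)

Section PrimeIdeals.
Variable R : pzRingType.
Implicit Types (I J P : set R) (a b x y : R).

Lemma ideal_opp I x : two_sided_ideal I -> I x -> I (- x).
Proof. by case=> _ _ IM _ Ix; rewrite -mulN1r; exact: IM. Qed.

Lemma prime_ideal_not1 P : prime_ideal P -> ~ P 1.
Proof.
case=> -[_ _ PM _] PT _ P1; apply: PT; rewrite -subTset => x _.
by rewrite -[x]mulr1; exact: PM.
Qed.

(** The elementwise form of primality avoids ideals generated by x and y: the
elements a with a R y in P form an ideal I, the elements b with I b in P form
an ideal J, and I J is contained in P. *)
Lemma prime_ideal_elt P x y :
  prime_ideal P -> (forall r, P (x * r * y)) -> P x \/ P y.
Proof.
move=> [[P0 PD PMl PMr] _ Pprime] Pxy.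
pose I := [set a | forall r, P (a * r * y)].
pose J := [set b | forall a, I a -> P (a * b)].
have idI : two_sided_ideal I.
  split=> [r|a b Ia Ib r|c a Ia r|c a Ia r]; first by rewrite !mul0r.
  - by rewrite !mulrDl; apply: PD; [exact: Ia|exact: Ib].
  - by rewrite -!mulrA; apply: PMl; rewrite mulrA; exact: Ia.
  - by rewrite -(mulrA a); exact: Ia.
have idJ : two_sided_ideal J.
  split=> [a _|b c Jb Jc a Ia|c b Jb a Ia|c b Jb a Ia]; first by rewrite mulr0.
  - by rewrite mulrDr; apply: PD; [exact: Jb|exact: Jc].
  - by rewrite mulrA; apply: Jb; case: idI => _ _ _; exact.
  - by rewrite mulrA; apply: PMr; exact: Jb.
have [IP|JP] := Pprime I J idI idJ (fun a b Ia Jb => Jb a Ia).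
  by left; exact: IP.
by right; apply: JP => a /(_ 1); rewrite mulr1.
Qed.

(** Multiply witnesses for the I k together, with factors r t y that elementwise
primality keeps outside P. *)
Lemma prime_not_sup_inter P (K : eqType) (s : seq K) (I : K -> set R) :
  prime_ideal P -> (forall k, k \in s -> two_sided_ideal (I k)) ->
  (forall k, k \in s -> ~ I k `<=` P) ->
  exists2 r, ~ P r & forall k, k \in s -> I k r.
Proof.
move=> Pp; elim: s => [|k s IHs] idI nI.
  by exists 1; [exact: prime_ideal_not1|].
have [||r nPr Ir] := IHs.
- by move=> l ls; apply: idI; rewrite inE ls orbT.
- by move=> l ls; apply: nI; rewrite inE ls orbT.
have /existsNP[y /not_implyP[Iy nPy]] := nI k (mem_head _ _).
have /existsNP[t nPt] : ~ forall t, P (r * t * y).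
  by move=> /(prime_ideal_elt Pp)[].
exists (r * t * y) => // l; rewrite inE => /predU1P[->|ls].
  by have [_ _ IM _] := idI k (mem_head _ _); exact: IM.
have [_ _ _ IM] : two_sided_ideal (I l) by apply: idI; rewrite inE ls orbT.
by apply/IM/IM/Ir.
Qed.
End PrimeIdeals.

Lemma prime_ideal_mul (A : comNzRingType) (p : set A) c d :
  prime_ideal p -> p (c * d) -> p c \/ p d.
Proof.
move=> pp pcd; apply: (prime_ideal_elt pp) => r.
by case: pp => -[_ _ pM _] _ _; rewrite mulrAC mulrC; exact: pM.
Qed.

(** * Submodules over a residue field *)

(** Over a field this says that the dimension is at most n; unlike linear
dependence over a domain, it passes to every residue field. *)
Definition unit_relations (A : comNzRingType) (M : lmodType A) (n : nat) :=
  forall x : 'I_n.+1 -> M, exists2 c : 'I_n.+1 -> A,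
    exists j, c j = 1 & \sum_i c i *: x i = 0.

Lemma exists_extremal (T : Type) (le : T -> T -> Prop) (X : set T) (x0 : T) :
  X x0 ->
  ~ (exists s : nat -> T, forall k,
       [/\ X (s k), le (s k) (s k.+1) & ~ le (s k.+1) (s k)]) ->
  exists2 x, X x & forall y, X y -> le x y -> le y x.
Proof.
move=> Xx0 nochain; apply: contrapT => noext; apply: nochain.
have /choice[g gP] (x : T) : exists y, X x -> [/\ X y, le x y & ~ le y x].
  apply: contrapT => nox; apply: noext; exists x.
    by apply: contrapT => nXx; apply: nox; exists x.
  by move=> y Xy lexy; apply: contrapT => nleyx; apply: nox; exists y.
have Xs k : X (iter k g x0) by elim: k => // k IH; have [] := gP _ IH.
by exists (fun k => iter k g x0) => k; have [] := gP _ (Xs k).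
Qed.

Section LocalSubmodules.
Variables (A : comNzRingType) (M : lmodType A) (n : nat) (p : set A).
Hypothesis relM : unit_relations M n.
Hypothesis p1 : ~ p 1.

(** The preimages in M of the k(p)-subspaces of the tensor product of M with the
residue field k(p). *)
Definition local_submodule (N : set M) : Prop :=
  [/\ N 0, forall x y, N x -> N y -> N (x + y),
      forall c x, N x -> N (c *: x), forall c x, p c -> N (c *: x)
    & forall s x, ~ p s -> N (s *: x) -> N x].

(** Elements x_i of N_(i+1) outside N_i are independent over k(p): in a
relation, the last coefficient outside p would force its x_j into N_j.  The
n + 1 of them contradict the bound on the dimension. *)
Lemma no_long_chain (N : nat -> set M) :
  (forall k, local_submodule (N k)) -> (forall k, N k `<=` N k.+1) ->
  ~ forall k, (k <= n)%N -> ~ N k.+1 `<=` N k.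
Proof.
move=> locN incN strN.
have homN i j : (i <= j)%N -> N i `<=` N j.
  elim: j => [|j IH]; first by rewrite leqn0 => /eqP->.
  by rewrite leq_eqVlt => /predU1P[->//|/IH] /subset_trans; apply.
have /choice[x Nx] (i : 'I_n.+1) : exists x, N i.+1 x /\ ~ N i x.
  have /existsNP[x /not_implyP[? ?]] := strN i (ltn_ord i).
  by exists x.
have [c [j0 cj0] rel] := relM x.
pose out := [pred i | `[< ~ p (c i) >]].
have out0 : out j0 by apply/asboolP; rewrite cj0.
have [j /asboolP outj maxj] := arg_maxnP (fun i : 'I_n.+1 => i : nat) out0.
case: (Nx j) => _; apply; have [N0 ND NZ pN NS] := locN j.
apply: (NS (c j)) => //; move: rel; rewrite (bigD1 j) //= => /eqP.
rewrite addr_eq0 => /eqP->; rewrite -scaleN1r; apply: (NZ).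
elim/big_ind: _ => // i ij; have [ltij|leji] := ltnP i j.
  by apply/NZ/(homN _ _ ltij)/(Nx i).1.
apply: pN; apply: contrapT => /asboolP/maxj /= leij.
by move/eqP: ij; apply; apply/val_inj/eqP; rewrite eqn_leq leij.
Qed.

Lemma exists_maximal (X : set (set M)) (N0 : set M) :
  X `<=` local_submodule -> X N0 ->
  exists2 N, X N & forall N', X N' -> N `<=` N' -> N' `<=` N.
Proof.
move=> locX XN0; apply: (exists_extremal XN0) => -[N NP].
apply: (@no_long_chain N) => k; last move=> _; have [XN le nge] := NP k => //.
exact: locX.
Qed.

Lemma exists_minimal (X : set (set M)) (N0 : set M) :
  X `<=` local_submodule -> X N0 ->
  exists2 N, X N & forall N', X N' -> N' `<=` N -> N `<=` N'.
Proof.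
move=> locX XN0; apply: (exists_extremal (le := fun N N' => N' `<=` N) XN0).
move=> -[N NP].
(* A long descending chain, read backwards. *)
apply: (@no_long_chain (fun k => N (n.+1 - k)%N)) => k.
- by have [/locX] := NP (n.+1 - k)%N.
- have [lekn|ltnk] := leqP k n; rewrite subSS.
    by rewrite subSn //; have [] := NP (n - k)%N.
  by move: ltnk (ltnW ltnk); rewrite -!subn_eq0 => /eqP-> /eqP->.
- by move=> lekn; rewrite subSS subSn //; have [] := NP (n - k)%N.
Qed.
End LocalSubmodules.

(** * Sets without large finite subsets *)

Lemma card_le_I_of_no_inj (T : pointedType) (X : set T) (m : nat) :
  (forall f : 'I_m.+1 -> T, (forall i, X (f i)) -> ~ injective f) -> X #<= `I_m.
Proof.
move=> noinj; have [leX|/negP nle] := boolP (X #<= `I_m); first by [].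
suff /pcard_leP/injfunPex[f fX finj] : `I_m.+1 #<= X.
  case: (noinj (fun i : 'I_m.+1 => f i)) => [i|i j fij].
    exact: fX (ltn_ord i).
  by apply/val_inj/finj => //; rewrite inE /=.
have [[k kX]|/infiniteP] := pselect (finite_set X).
  have := kX; rewrite card_eq_le => /andP[Xk kX'].
  apply: card_le_trans kX'; rewrite card_le_II ltnNge; apply/negP => lekm.
  by apply: nle; apply: card_le_trans Xk _; rewrite card_le_II.
exact/card_le_trans/card_leT.
Qed.

(** * Primes of an algebra lying over a given prime *)

Section Contraction.
Variables (A : comNzRingType) (R : algType A).
Implicit Types (I J Q : set R) (p : set A).

Definition contraction I : set A := [set c | I c%:A].

Lemma ideal_scale I c x : two_sided_ideal I -> I x -> I (c *: x).
Proof. by case=> _ _ IM _ Ix; rewrite -mulr_algl; exact: IM. Qed.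

Lemma contraction_scale I c x :
  two_sided_ideal I -> contraction I c -> I (c *: x).
Proof. by case=> _ _ _ IM Ic; rewrite -mulr_algl; exact: IM. Qed.

Lemma contraction_ideal I : two_sided_ideal I -> two_sided_ideal (contraction I).
Proof.
move=> idI; have [I0 ID _ _] := idI; split=> [|c d Ic Id|c d Id|c d Id];
  rewrite /contraction /= ?scale0r ?scalerDl //; first exact: ID.
- by rewrite -scalerA; exact: ideal_scale.
- by rewrite mulrC -scalerA; exact: ideal_scale.
Qed.

Lemma prime_cancel Q s x :
  prime_ideal Q -> ~ contraction Q s -> Q (s *: x) -> Q x.
Proof.
move=> Qp nQs Qsx; have [|//|//] := @prime_ideal_elt _ Q s%:A x Qp.
move=> r; have [[_ _ QM _] _ _] := Qp.
by rewrite mulr_algl -scalerAl scalerAr; exact: QM.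
Qed.

Lemma contraction_prime Q : prime_ideal Q -> prime_ideal (contraction Q).
Proof.
move=> Qp; have [idQ _ _] := Qp; split.
- exact: contraction_ideal.
- move=> cT; apply: (prime_ideal_not1 Qp); have : setT (1 : A) by [].
  by rewrite -cT /contraction /= scale1r.
move=> I J _ _ IJ; apply: contrapT => /not_orP[/existsNP[c /not_implyP[Ic nQc]]].
move=> /existsNP[d /not_implyP[Jd nQd]]; apply/nQd/(prime_cancel Qp nQc).
by rewrite scalerA; exact: IJ.
Qed.

Variable n : nat.
Hypothesis relR : unit_relations R n.

(** This is the fact that a nonzero ideal of a prime finite dimensional algebra
is everything.  A minimal left ideal L is simple, and J x = L for each nonzero x
in L since J kills no such x; hence each x is killed by some 1 - j with j in J.
As L has finite dimension, a product a = 1 - j' of such elements kills all of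
L; then a R kills L, so a = 0 by primeness, and 1 = j' is in J.  Below, elements
s outside p stand for 1, and all equations hold modulo Q. *)
Lemma prime_incomparable Q J :
  prime_ideal Q -> two_sided_ideal J -> Q `<=` J ->
  contraction J `<=` contraction Q -> J `<=` Q.
Proof.
move=> Qp idJ QJ JQ x0 Jx0; apply: contrapT => nQx0.
have [idQ _ _] := Qp; have [Q0 QD QMl QMr] := idQ; have [J0 JD JMl JMr] := idJ.
set p := contraction Q in JQ.
have pp : prime_ideal p := contraction_prime Qp.
have p1 : ~ p 1 := prime_ideal_not1 pp.
have pS s t : ~ p s -> ~ p t -> ~ p (s * t).
  by move=> ns nt /(prime_ideal_mul pp)[].
pose X := [set L : set R | [/\ local_submodule p L, Q `<=` L, ~ L `<=` Q
  & forall a x, L x -> L (a * x)]].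
have [||L [locL QL LQ LM] minL] := @exists_minimal A R n p relR p1 X setT.
- by move=> L [].
- by split=> // /(_ 1 I); exact: prime_ideal_not1.
have [L0 LD LZ pL LS] := locL.
have killx x : L x -> ~ Q x ->
    exists a s, [/\ ~ p s, J (s%:A - a) & Q (a * x)].
  move=> Lx nQx.
  (* The elements of L that lie in J x modulo Q and denominators. *)
  pose L' := [set y | L y /\ exists s j, [/\ ~ p s, J j & Q (s *: y - j * x)]].
  have QL' y : Q y -> L' y.
    by move=> Qy; split; [exact: QL|exists 1, 0; rewrite mul0r subr0 scale1r].
  have L'x : L' x.
    apply: (minL L') => //; last by move=> y [].
    split=> //; last first.
    + move=> a y [Ly [s [j [ns Jj Qj]]]]; split; first exact: LM.
      exists s, (a * j); split=> //; first exact: JMl.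
      by rewrite scalerAr -mulrA -mulrBr; exact: QMl.
    + move=> L'Q; have [|//|//] := @prime_ideal_elt _ Q x0 x Qp.
      move=> r; apply: L'Q; split; first exact: LM.
      by exists 1, (x0 * r); rewrite scale1r subrr; split=> //; exact: JMr.
    split.
    + exact: QL'.
    + move=> y z [Ly [s [j [ns Jj Qj]]]] [Lz [t [k [nt Jk Qk]]]].
      split; first exact: LD.
      exists (s * t), (t *: j + s *: k); split; first exact: pS.
        by apply: JD; exact: ideal_scale.
      rewrite (_ : _ - _ = t *: (s *: y - j * x) + s *: (t *: z - k * x)).
        by apply: QD; exact: ideal_scale.
      rewrite mulrDl -!scalerAl !scalerBr scalerDr !scalerA (mulrC t s) opprD.
      exact: addrACA.
    + move=> c y [Ly [s [j [ns Jj Qj]]]]; split; first exact: LZ.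
      exists s, (c *: j); split=> //; first exact: ideal_scale.
      by rewrite scalerA mulrC -scalerA -scalerAl -scalerBr; exact: ideal_scale.
    + by move=> c y pc; apply: QL'; exact: contraction_scale.
    + move=> t y nt [Ly [s [j [ns Jj Qj]]]]; split; first exact: LS Ly.
      by exists (s * t), j; split=> //; [exact: pS|rewrite -scalerA].
  have [_ [s [j [ns Jj Qj]]]] := L'x.
  exists (s%:A - j), s; split=> //; first by rewrite opprB addrC subrK.
  by rewrite mulrBl mulr_algl.
(* Take a, congruent modulo J to an element outside p, killing as much as
   possible modulo Q. *)
pose K (a : R) := [set y | Q (a * y)].
pose Y := [set N | exists a s, [/\ N = K a, ~ p s & J (s%:A - a)]].
have [||_ [a [s [-> ns Ja]]] maxa] := @exists_maximal A R n p relR p1 Y (K 1).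
- move=> _ [a [_ [-> _ _]]]; split=> [|y z|c y|c y pc|s y ns];
    rewrite /K /= -?scalerAr ?mulr0 ?mulrDr //; first exact: QD.
  + exact: ideal_scale.
  + exact: contraction_scale.
  + exact: prime_cancel.
- by exists 1, 1; split=> //; rewrite scale1r subrr.
have aL y : L y -> Q (a * y).
  move=> Ly; apply: contrapT => nQay.
  have [b [t [nt Jb Qb]]] := killx _ (LM a y Ly) nQay.
  apply: nQay; apply: (maxa (K (b * a))) => [|z Kz|].
  - exists (b * a), (t * s); split=> //; first exact: pS.
    rewrite (_ : _ - _ = t *: (s%:A - a) + (t%:A - b) * a).
      by apply: JD; [exact: ideal_scale|exact: JMr].
    by rewrite mulrBl mulr_algl scalerBr scalerA addrA subrK.
  - by rewrite /K /= -mulrA; exact: QMl.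
  - by rewrite /K /= -mulrA.
have /existsNP[y /not_implyP[Ly nQy]] := LQ.
have [|Qa|//] := @prime_ideal_elt _ Q a y Qp.
  by move=> r; rewrite -mulrA; exact/aL/LM.
by apply: ns; apply: JQ; rewrite /contraction /= -(subrK a s%:A); exact/JD/QJ.
Qed.

Lemma fibre_bound p (Q : 'I_n.+1 -> set R) :
  (forall i, prime_ideal (Q i)) -> (forall i, contraction (Q i) = p) ->
  ~ injective Q.
Proof.
move=> Qp Qc injQ.
have idQ i : two_sided_ideal (Q i) by case: (Qp i).
have /choice[r rP] (i : 'I_n.+1) :
    exists r, ~ Q i r /\ forall k, k != i -> Q k r.
  have [||r nQr rP] := prime_not_sup_inter (Qp i)
    (s := [seq k <- enum 'I_n.+1 | k != i]) (I := Q).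
  - by [].
  - move=> k; rewrite mem_filter => /andP[/eqP ki _] Qki; apply/ki/injQ/seteqP.
    split=> //; apply: prime_incomparable => //; last by rewrite !Qc.
  by exists r; split=> // k ki; apply: rP; rewrite mem_filter ki mem_enum.
have [c [j cj] rel] := relR r.
have [nQj _] := rP j; apply: nQj; move/eqP: rel.
rewrite (bigD1 j) //= cj scale1r addr_eq0 => /eqP->.
apply: ideal_opp => //; have [Q0 QD _ _] := idQ j.
elim/big_ind: _ => // i ij; apply: ideal_scale => //.
by apply: (rP i).2; rewrite eq_sym.
Qed.

(** Number the primes in each fibre; Q is determined by its number and its
contraction. *)
Lemma Spec_upper_bound : Spec R #<= `I_n `*` Spec A.
Proof.
have /choice[f fP] (p : set A) : exists f : set R -> nat,
    set_fun [set Q | prime_ideal Q /\ contraction Q = p] `I_n f /\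
    set_inj [set Q | prime_ideal Q /\ contraction Q = p] f.
  suff /pcard_leP/injfunPex[f] :
    [set Q | prime_ideal Q /\ contraction Q = p] #<= `I_n by exists f.
  apply: card_le_I_of_no_inj => Q QP.
  by apply: (@fibre_bound p) => i; have [] := QP i.
apply/pcard_leP/injfunPex;
  exists (fun Q => (f (contraction Q) Q, contraction Q)).
  by move=> Q Qp; split; [apply: (fP _).1|exact: contraction_prime].
move=> Q Q'; rewrite !inE => Qp Qp' [+ cE]; rewrite cE.
by apply: (fP _).2; rewrite inE.
Qed.
End Contraction.

(** * Lying over *)

Section LyingOver.
Variables (A : comNzRingType) (R : algType A) (n : nat).
Hypothesis relR : unit_relations R n.
Hypothesis divA : forall a b : A,
  (exists d, a = b * d) \/ (exists d, b = a * d).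
Hypothesis tfR : torsion_free R.
Hypothesis unitR : forall c : A, is_unit (c%:A : R) -> is_unit c.

Lemma lying_over (p : set A) :
  prime_ideal p -> exists2 Q : set R, prime_ideal Q & contraction Q = p.
Proof.
move=> pp; have p1 := prime_ideal_not1 pp.
have [[p0 pD pM _] _ _] := pp.
have pS s t : ~ p s -> ~ p t -> ~ p (s * t).
  by move=> ns nt /(prime_ideal_mul pp)[].
pose X := [set N : set R | [/\ two_sided_ideal N, local_submodule p N & ~ N 1]].
(* The local closure of pR; since p R consists of single products q r, no sums
   are needed. *)
pose N0 := [set x : R | exists s q r, [/\ ~ p s, p q & s *: x = q *: r]].
have addN0 q r q' r' : p q -> p q' ->
    exists2 q2, p q2 & exists r2 : R, q *: r + q' *: r' = q2 *: r2.
  move=> pq pq'; have [[d ->]|[d ->]] := divA q q'.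
    by exists q' => //; exists (d *: r + r'); rewrite scalerDr scalerA.
  by exists q => //; exists (r + d *: r'); rewrite scalerDr scalerA.
have XN0 : X N0.
  have N00 : N0 0 by exists 1, 0, 0; rewrite !scaler0.
  have N0D x y : N0 x -> N0 y -> N0 (x + y).
    move=> [s [q [r [ns pq sx]]]] [t [q' [r' [nt pq' ty]]]].
    have [q2 pq2 [r2 r2E]] :=
      addN0 (t * q) r (s * q') r' (pM _ _ pq) (pM _ _ pq').
    exists (s * t), q2, r2; split=> //; first exact: pS.
    by rewrite -r2E -!scalerA -sx -ty !scalerDr !scalerA (mulrC t s).
  split.
  - split=> // a x [s [q [r [ns pq sx]]]].
      by exists s, q, (a * r); rewrite scalerAr sx scalerAr.
    by exists s, q, (r * a); rewrite scalerAl sx scalerAl.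
  - split=> // [c x [s [q [r [ns pq sx]]]]|c x pc|t x nt [s [q [r [ns pq sx]]]]].
    + by exists s, q, (c *: r); rewrite scalerA mulrC -scalerA sx !scalerA mulrC.
    + by exists 1, c, x; rewrite scale1r.
    + by exists (s * t), q, r; split=> //; [exact: pS|rewrite -scalerA].
  - move=> [s [q [r [ns pq s1]]]].
    have [[d qE]|[d sE]] := divA q s; last first.
      by apply: ns; rewrite sE mulrC; exact: pM.
    have pd : p d by move: pq; rewrite qE => /(prime_ideal_mul pp)[].
    have [s0|/subr0_eq dr] : s = 0 \/ (1 - d *: r : R) = 0.
    + by apply: tfR; rewrite scalerBr s1 qE scalerA subrr.
    + by apply: ns; rewrite s0.
    + have [|b [_ bd]] := @unitR d; last by apply: p1; rewrite -bd; exact: pM.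
      by exists r; rewrite mulr_algl mulr_algr.
have [|Q [idQ locQ Q1] maxQ] := @exists_maximal A R n p relR p1 X N0 _ XN0.
  by move=> N [].
have [Q0 QD QMl QMr] := idQ; have [_ _ QZ pQ QS] := locQ.
(* By maximality of Q, the local closure of Q + I contains 1. *)
have meetS I : two_sided_ideal I -> ~ I `<=` Q ->
    exists s i, [/\ ~ p s, I i & Q (s%:A - i)].
  move=> idI IQ; have [I0 ID IMl IMr] := idI; apply: contrapT => no1.
  pose Q' := [set y | exists s i, [/\ ~ p s, I i & Q (s *: y - i)]].
  have QQ' : Q `<=` Q' by move=> y Qy; exists 1, 0; rewrite scale1r subr0.
  have IQ' : I `<=` Q' by move=> y Iy; exists 1, y; rewrite scale1r subrr.
  have Q'D x y : Q' x -> Q' y -> Q' (x + y).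
    move=> [s [i [ns Ii Qi]]] [t [j [nt Ij Qj]]].
    exists (s * t), (t *: i + s *: j); split; first exact: pS.
      by apply: ID; exact: ideal_scale.
    rewrite (_ : _ - _ = t *: (s *: x - i) + s *: (t *: y - j)).
      by apply: QD; exact: QZ.
    by rewrite !scalerBr scalerDr !scalerA (mulrC t s) opprD addrACA.
  apply/IQ/(subset_trans IQ')/maxQ => //; split=> //; first split=> //.
  - exact: QQ'.
  - move=> a x [s [i [ns Ii Qi]]]; exists s, (a * i); split=> //; first exact: IMl.
    by rewrite scalerAr -mulrBr; exact: QMl.
  - move=> a x [s [i [ns Ii Qi]]]; exists s, (i * a); split=> //; first exact: IMr.
    by rewrite scalerAl -mulrBl; exact: QMr.
  - split=> //; first exact: QQ'.
    + move=> c x [s [i [ns Ii Qi]]]; exists s, (c *: i); split=> //.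
        exact: ideal_scale.
      by rewrite scalerA mulrC -scalerA -scalerBr; exact: QZ.
    + by move=> c x pc; apply: QQ'; exact: pQ.
    + move=> t x nt [s [i [ns Ii Qi]]]; exists (s * t), i; split=> //.
        exact: pS.
      by rewrite -scalerA.
exists Q; last first.
  apply/seteqP; split=> c; last exact: pQ.
  by move=> Qc; apply: contrapT => npc; exact/Q1/(QS c).
split=> // [QT|I J idI idJ IJ]; first by apply: Q1; rewrite QT.
apply: contrapT => /not_orP[/(meetS I idI)[s [i [ns Ii Qi]]]].
move=> /(meetS J idJ)[t [j [nt Jj Qj]]].
apply/Q1/(QS (s * t)); first exact: pS.
rewrite (_ : _ *: _ = t *: (s%:A - i) + (i * (t%:A - j) + i * j)).
  by apply: (QD); [exact: QZ|apply: (QD); [exact: QMl|exact: IJ]].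
by rewrite -mulrDr subrK mulr_algr scalerBr subrK scalerA mulrC.
Qed.

Lemma Spec_lower_bound : Spec A #<= Spec R.
Proof.
have /choice[g gP] (p : set A) :
    exists Q : set R, prime_ideal p -> prime_ideal Q /\ contraction Q = p.
  have [/lying_over[Q Qp Qc]|np] := pselect (prime_ideal p); first by exists Q.
  by exists set0 => /np.
apply/pcard_leP/injfunPex; exists g => [p /gP[]//|p p'].
by rewrite !inE => /gP[_ pE] /gP[_ p'E] gE; rewrite -pE gE p'E.
Qed.
End LyingOver.

(** * Torsion-free modules embed in their base change to the fraction field *)

Section PureTensors.
Variables (A B : comNzRingType) (f : {rmorphism A -> B}) (M : lmodType A).

Lemma pure_tensorDl (b : B) (m m' : M) :
  pure_tensor f (m + m') b = pure_tensor f m b + pure_tensor f m' b.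
Proof.
apply/eqP; rewrite -subr_eq0 opprD addrA -!raddfB /=.
by apply/eqP/tensor_class_eq0; exact: TensorRelDl.
Qed.

Lemma pure_tensorZ (a : A) (m : M) (b : B) :
  pure_tensor f (a *: m) b = f a *: pure_tensor f m b.
Proof.
rewrite base_change_scale_pure; apply/eqP; rewrite -subr_eq0 -raddfB.
by apply/eqP/tensor_class_eq0; exact: TensorRelZ.
Qed.
End PureTensors.

Section TensorInjective.
Variables (A : comNzRingType) (K : fieldType) (f : {rmorphism A -> K}).
Variable M : lmodType A.
Hypothesis injf : injective f.
Hypothesis fracf : forall b, exists2 d : A, d != 0 & exists a, f d * b = f a.
Hypothesis tfM : torsion_free M.

Let g_exists : exists g : K -> A, cancel f g.
Proof.
have /choice[g gP] (b : K) : exists a : A, forall a', f a' = b -> a = a'.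
  have [[a <-]|nb] := pselect (exists a, f a = b).
    by exists a => a' /injf.
  by exists 0 => a' fa'; case: nb; exists a'.
by exists g => a; exact: gP.
Qed.

(** For d in A, the assignment (x, b) |-> (d b) x, with some junk value when d b
is not in A, extends to an additive map [phi d] to M.  It kills an element that
is zero in the tensor product as soon as d is a multiple of the denominators
occurring in a derivation of this fact, and it sends (m, 1) to d m. *)
Lemma pure_tensor_inj (m : M) : pure_tensor f m 1 = 0 -> m = 0.
Proof.
have [g fK] := g_exists.
have f_eq0 (d : A) : (f d == 0) = (d == 0) by rewrite -(inj_eq injf) rmorph0.
have nzM (d d' : A) : d != 0 -> d' != 0 -> d * d' != 0.
  by rewrite -!f_eq0 rmorphM; exact: mulf_neq0.
pose phi d : {freeg (M * K)} -> zmodule M :=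
  fglift (fun p : M * K => g (f d * p.2) *: p.1 : zmodule M).
have phiB d s t : phi d (s - t) = phi d s - phi d t by exact: lift_is_additive.
have phiE d x b e : f d * b = f e -> phi d << (x, b) >> = e *: x.
  by move=> de; rewrite /phi liftU scale1r /= de fK.
have killed s : tensor_relation f s ->
    exists2 d, d != 0 & forall a, phi (a * d) s = 0.
  elim=> [|t u _ [d d0 kt] _ [d' d'0 ku]|x y b|x b b'|c x b].
  - by exists 1 => [|a]; [exact: oner_neq0|rewrite -(subrr 0) phiB subrr].
  - exists (d * d') => [|a]; first exact: nzM.
    by rewrite phiB (mulrC d) mulrA kt -mulrA (mulrC d') mulrA ku subrr.
  - have [d d0 [e de]] := fracf b; exists d => // a.
    have ade : f (a * d) * b = f (a * e) by rewrite !rmorphM -mulrA de.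
    by rewrite !phiB !(phiE _ _ _ _ ade) scalerDr addrAC addrK subrr.
  - have [d d0 [e de]] := fracf b; have [d' d'0 [e' de']] := fracf b'.
    exists (d * d') => [|a]; first exact: nzM.
    have bE : f (a * (d * d')) * b = f (a * d' * e).
      by rewrite !rmorphM -de -!mulrA (mulrCA (f d)).
    have b'E : f (a * (d * d')) * b' = f (a * d * e').
      by rewrite !rmorphM -de' -!mulrA.
    have bb'E : f (a * (d * d')) * (b + b') = f (a * d' * e + a * d * e').
      by rewrite mulrDr bE b'E rmorphD.
    rewrite !phiB (phiE _ _ _ _ bE) (phiE _ _ _ _ b'E) (phiE _ _ _ _ bb'E).
    by rewrite scalerDl addrAC addrK subrr.
  - have [d d0 [e de]] := fracf b; exists d => // a.
    have ade : f (a * d) * b = f (a * e) by rewrite !rmorphM -mulrA de.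
    have cade : f (a * d) * (f c * b) = f (a * e * c).
      by rewrite mulrCA ade -rmorphM mulrC.
    by rewrite phiB (phiE _ _ _ _ ade) (phiE _ _ _ _ cade) scalerA subrr.
move=> /tensor_class_eq0/killed[d d0 /(_ 1)].
rewrite (phiE _ _ _ d) ?mul1r ?mulr1 //.
by move=> /tfM[/eqP|//]; rewrite (negPf d0).
Qed.
End TensorInjective.

(** * Valuation rings *)

Section ValuationRingFacts.
Variables (F : fieldType) (G : orderedAbGroupType) (v : valuation F G).
Local Notation O := (valuation_ring v).

Lemma ext_le_total (a b : option G) : ext_le a b || ext_le b a.
Proof. by case: a b => [a|] [b|] //=; exact: oag_total. Qed.

Lemma val_le_div x y :
  y != 0 -> ext_le (v y) (v x) -> x / y \in valuation_ring_pred v.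
Proof.
move=> y0; have := val_M v (x / y) y; rewrite divfK // => ->.
rewrite unfold_in /valuation_ring_pred.
case vy : (v y) => [h|]; last by move/val_eqN/eqP: vy; rewrite (negPf y0).
case: (v (x / y)) => [g|] //= hg.
by have := oag_lerD2l _ _ (- h) hg; rewrite addNr [g + h]addrC addKr.
Qed.

Lemma min_val_coef (I : finType) (u : I -> F) i0 : u i0 != 0 ->
  exists2 j, u j != 0 & forall i, u i / u j \in valuation_ring_pred v.
Proof.
move=> ui0.
have [||||j _ minj] := @extremumP _ _ (@ext_le G) i0 xpredT (v \o u).
- by case=> [a|] //=; exact: lexx.
- by move=> b a c; exact: ext_le_trans.
- exact: ext_le_total.
- by [].
have uj : u j != 0.
  apply: contra ui0 => /eqP uj0; have := minj i0 isT.
  rewrite /= uj0 ((val_eqN v 0).2 erefl); case E: (v _) => // _.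
  by move/val_eqN: E => ->.
by exists j => // i; apply: val_le_div => //; exact: minj.
Qed.

Lemma valuation_ring_div (a b : O) :
  (exists d, a = b * d) \/ (exists d, b = a * d).
Proof.
have lift (x y : O) : ext_le (v (val y)) (v (val x)) -> exists d, x = y * d.
  have [y0|ny0] := eqVneq (val y) 0.
    rewrite y0 ((val_eqN v 0).2 erefl); case E: (v _) => [//|] _; exists 0.
    by apply: val_inj; rewrite mulr0 raddf0; exact: (val_eqN v _).1 E.
  move=> /(val_le_div ny0) xy; exists (ValuationRing xy).
  by apply: val_inj; rewrite /= [RHS]mulrC divfK.
by have /orP[/lift|/lift] := ext_le_total (v (val b)) (v (val a)); [left|right].
Qed.

Lemma valuation_ring_frac (b : F) :
  exists2 d : O, d != 0 &
    exists a, valuation_ring_incl v d * b = valuation_ring_incl v a.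
Proof.
have [bO|] := boolP (b \in valuation_ring_pred v).
  by exists 1; [exact: oner_neq0|exists (ValuationRing bO); rewrite rmorph1 mul1r].
move=> nbO; have b0 : b != 0.
  by apply: contraNneq nbO => ->; rewrite -[0](subrr 1) rpredB ?rpred1.
have bVO : b^-1 \in valuation_ring_pred v.
  rewrite -[b^-1]mul1r; apply: val_le_div => //.
  have /orP[//|le1b] := ext_le_total (v b) (v 1).
  by move: nbO; rewrite -[b]divr1 val_le_div ?oner_eq0.
exists (ValuationRing bVO); last by exists 1; rewrite rmorph1 /= mulVf.
by rewrite -(inj_eq val_inj) /= invr_eq0.
Qed.

(** Dividing by a coefficient of least value puts all coefficients in O and
makes that one equal to 1. *)
Lemma base_change_unit_relations (M : lmodType O) n : torsion_free M ->
  has_dimension (base_change (valuation_ring_incl v) M) n -> unit_relations M n.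
Proof.
move=> tfM [e [_ span]] x; set f := valuation_ring_incl v.
have /choice[a aE] (i : 'I_n.+1) : exists a : 'I_n -> F,
    pure_tensor f (x i) 1 = \sum_j a j *: e j by exact: span.
pose B : 'M[F]_(n.+1, n) := \matrix_(i, j) a i j.
have /rowV0Pn[u /sub_kermxP uB] : kermx B != 0.
  by rewrite kermx_eq0 /row_free neq_ltn (leq_ltn_trans (rank_leq_col B)).
move=> /rV0Pn[i0 ui0].
have [j uj uO] := min_val_coef (u := u 0) ui0.
exists (fun i => ValuationRing (uO i)).
  by exists j; apply: val_inj; rewrite /= divff.
have pure0 : pure_tensor f (0 : M) 1 = 0.
  by rewrite -[in LHS](scale0r (0 : M)) pure_tensorZ rmorph0 scale0r.
apply: (@pure_tensor_inj _ _ f) => //.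
  exact: valuation_ring_frac.
rewrite (big_morph _ (@pure_tensorDl _ _ f M 1) pure0).
under eq_bigr do rewrite pure_tensorZ aE scaler_sumr.
rewrite exchange_big big1 // => k _.
under eq_bigr do rewrite scalerA.
rewrite -scaler_suml [X in X *: _](_ : _ = 0) ?scale0r //.
transitivity ((u 0 j)^-1 * (u *m B) 0 k); last by rewrite uB mxE mulr0.
rewrite mxE mulr_sumr; apply: eq_bigr => i _.
by rewrite mxE /= mulrAC mulrC.
Qed.
End ValuationRingFacts.

Theorem theorem2p13 (F : fieldType) (G : orderedAbGroupType)
    (v : valuation F G) (R : algType (valuation_ring v)) (n : nat) :
  nontrivial_valuation v ->
  torsion_free R ->
  has_dimension (base_change (valuation_ring_incl v) R) n ->
  (forall c : valuation_ring v, is_unit (c%:A : R) -> is_unit c) ->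
  Spec (valuation_ring v) #<= Spec R /\
  Spec R #<= `I_n `*` Spec (valuation_ring v).
Proof.
move=> _ tfR dimR unitR.
have relR := base_change_unit_relations tfR dimR.
split; last exact: Spec_upper_bound.
exact: (Spec_lower_bound relR (@valuation_ring_div F G v) tfR unitR).
Qed.
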